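(* Let $\{X_\alpha:\alpha\in\Lambda\}$ be any family of compact spaces each of which is $\mathrm{I}$-favorable with respect to co-zero sets. Then the product $\prod_{\alpha\in\Lambda}X_\alpha$ is $\mathrm{I}$-favorable with respect to co-zero sets.
   Context: All spaces are Tychonoff (so compact spaces are compact Hausdorff). **I-favorable with respect to co-zero sets.** Let $\Sigma_X$ be the family of all non-empty co-zero sets in a space $X$. Two players play as follows: at round $n\ge 0$ Player I chooses $A_n\in\Sigma_X$ and Player II replies with $B_n\in\Sigma_X$, $B_n\subset A_n$. Player I wins if $\bigcup_{n\ge 0}B_n$ is dense in $X$; otherwise Player II wins. $X$ is $\mathrm{I}$-favorable with respect to co-zero sets if Player I has a winning strategy, i.e. a function $\sigma:\bigcup\{\Sigma_X^n:n\ge 0\}\to\Sigma_X$ such that for every play in which Player I plays $A_0=\sigma(\varnothing)$ (value at the empty sequence) and $A_{k+1}=\sigma(B_0,\dots,B_k)$ for all $k\ge 0$, and Player II plays $B_k\in\Sigma_X$ with $B_k\subset A_k$ for all $k\geq 0$, the union $\bigcup_{n\ge 0}B_n$ is dense in $X$. *)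

(* Defs.v *)
From HB Require Import structures.
From mathcomp Require Import all_boot all_order all_algebra.
From mathcomp Require Import all_classical all_reals all_analysis.
Set Implicit Arguments.
Unset Strict Implicit.
Unset Printing Implicit Defensive.
Import Order.TTheory GRing.Theory Num.Theory.
Import numFieldNormedType.Exports.
Local Open Scope classical_set_scope.
Local Open Scope ring_scope.

Definition cozero (R : realType) (X : topologicalType) (A : set X) : Prop :=
  exists f : X -> R, continuous f /\ A = [set x | f x != 0].

Definition Sigma (R : realType) (X : topologicalType) : Type :=
  {A : set X | A !=set0 /\ cozero R A}.

Definition Sigma_set (R : realType) (X : topologicalType) (A : Sigma R X) :
  set X := sval A.

Coercion Sigma_set : Sigma >-> set.

(* [mkseq B k] is the sequence (B 0, ..., B (k - 1)) of the moves of Player II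
   before round k, so [sigma (mkseq B k)] is the move of Player I at round k. *)
Definition winning_strategy (R : realType) (X : topologicalType)
    (sigma : seq (Sigma R X) -> Sigma R X) : Prop :=
  forall B : nat -> Sigma R X,
    (forall k : nat, B k `<=` sigma (mkseq B k)) ->
    dense (\bigcup_(n in [set: nat]) (B n : set X)).

(* The empty space is not I-favorable: [Sigma R X] is then empty, so there is
   no value of a strategy at the empty sequence. *)
Definition I_favorable_cozero (R : realType) (X : topologicalType) : Prop :=
  exists sigma : seq (Sigma R X) -> Sigma R X, winning_strategy sigma.

(* Main.v *)
Require Import Defs.
From mathcomp Require Import all_boot all_order all_algebra.
From mathcomp Require Import all_classical all_reals all_analysis.
Set Implicit Arguments.
Unset Strict Implicit.
Unset Printing Implicit Defensive.
Local Open Scope classical_set_scope.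

(** Why the product is favorable.  Compact Hausdorff factors are completely
regular, so every non-empty open set of the product contains a box: a product
of non-empty co-zero sides over a finite support.  Each reply of Player II may
thus be shrunk to a box [b k], with support [S k] and sides [u k i]; a side is
chosen for every coordinate [i], also off the support.

The factor strategies enter through a reflection principle
([winning_strategy_meets]).  Fix a coordinate [i], its strategy [sigma i] and
the sequence of all sides [u k i].  Every non-empty open [V] then admits a
finite sequence of indices [s] such that any [u k i] inside
[sigma i (map (u^~ i) s)] meets [V]; otherwise Player II could answer
[sigma i] forever with sides missing [V], and would beat a winning strategy.

Player I therefore only has to play, sooner or later, every non-empty finite
intersection of preimages, under the projection to [i], of sets
[sigma i (map (u^~ i) s)], with [i] in some support and [s] a finite sequence
of indices.  There are countably many of these, because only countably many
coordinates occur in the supports, and each depends on finitely many replies,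
so an enumeration that repeats every item infinitely often
([cofinal_enumeration]) gets through all of them.

To see that this wins, take an open box with support [T] and sides [v i].  At
each [i] in [T] that occurs in some support, reflection gives an [s i], and at
some round [m] Player I plays the intersection of the corresponding preimages.
The reply contains the box of [S m] and [u m], whose side at each such [i] in
[S m] lies in [sigma i (map (u^~ i) (s i))], hence meets [v i].  At a
coordinate that is not in both [S m] and [T] at most one constraint applies, so
a common point of the two boxes is found coordinatewise. *)

(** * Bookkeeping *)

(** Enumerating pairs of an item and a padding number repeats each item at
infinitely many places; the pigeonhole principle makes these unbounded. *)
Lemma cofinal_enumeration (C : countType) (c0 : C) :
  exists e : nat -> C, forall c N, exists2 m, (N <= m)%N & e m = c.
Proof.
exists (fun m => oapp fst c0 (unpickle m : option (C * nat))) => c N.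
suff [r Nr] : exists r : nat, (N <= pickle (c, r))%N.
  by exists (pickle (c, r)) => //; rewrite pickleK.
apply: contrapT => /forallNP bound.
have pltN (r : nat) : (pickle (c, r) < N)%N by rewrite ltnNge; apply/negP/bound.
have /leq_card : injective (fun r : 'I_N.+1 => Ordinal (pltN r)).
  by move=> r r' [] /(pcan_inj pickleK) [] /val_inj.
by rewrite !card_ord ltnn.
Qed.

(** * Co-zero sets and the game on one space *)

Section Cozero.
Context {R : realType} {Y : topologicalType}.
Implicit Types A : set Y.
Import GRing.Theory numFieldNormedType.Exports.
Local Open Scope ring_scope.

Lemma cozeroT : cozero R [set: Y].
Proof.
exists (cst 1); split; first exact: cst_continuous.
by apply/seteqP; split=> x //= _; rewrite oner_neq0.
Qed.

Lemma cozeroI A B : cozero R A -> cozero R B -> cozero R (A `&` B).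
Proof.
move=> [f [cf ->]] [g [cg ->]]; exists (fun x => f x * g x).
split; first by move=> x; apply: cvgM; [exact: cf|exact: cg].
apply/seteqP; split=> x /=; rewrite mulf_eq0 negb_or; first by case=> -> ->.
by case/andP.
Qed.

Lemma cozero_preimage (Z : topologicalType) (h : Y -> Z) (A : set Z) :
  continuous h -> cozero R A -> cozero R (h @^-1` A).
Proof.
move=> ch [f [cf ->]]; exists (f \o h); split=> // x.
by apply: continuous_comp; [exact: ch|exact: cf].
Qed.

Lemma cozero_bigcap_seq (T : eqType) (r : seq T) (A : T -> set Y) :
  (forall t, cozero R (A t)) -> cozero R [set x | forall t, t \in r -> A t x].
Proof.
move=> cA; elim: r => [|t r IH].
  by rewrite (_ : [set x | _] = setT); [exact: cozeroT|apply/seteqP; split].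
rewrite (_ : [set x | _] = A t `&` [set x | forall t, t \in r -> A t x]).
  exact: cozeroI.
apply/seteqP; split=> x /=.
  by move=> Ax; split=> [|q qr]; apply: Ax; rewrite inE ?eqxx// qr orbT.
by move=> [At Ar] q; rewrite inE => /orP[/eqP->|/Ar].
Qed.

Lemma cozero_open A : cozero R A -> open A.
Proof.
move=> [f [cf ->]].
apply: (open_comp (f := f) (D := [set y | y != 0])) => [y _|]; first exact: cf.
exact: open_neq.
Qed.

Lemma Sigma_neq0 (A : Sigma R Y) : (A : set Y) !=set0.
Proof. by case: A => A []. Qed.

Lemma Sigma_cozero (A : Sigma R Y) : cozero R (A : set Y).
Proof. by case: A => A []. Qed.

(** A function that separates [y] from the complement of an open set, taking
the value 1 on the latter, makes [1 - f] vanish outside that open set. *)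
Lemma completely_regular_Sigma (y : Y) (U : set Y) :
  completely_regular_space Y -> nbhs y U -> exists A : Sigma R Y, A `<=` U.
Proof.
move=> crY; rewrite nbhsE => -[V [oV Vy] VU].
have /uniform_separatorP-/(_ R) : uniform_separator [set y] (~` V).
  by apply: crY; [exact: open_closedC|exact].
move=> [f [cf _ f0 f1]].
have cg : continuous (fun x => 1 - f x).
  by move=> x; apply: cvgB; [exact: cvg_cst|exact: cf].
have fy : f y = 0 by apply: f0; exists y.
have ne : [set x | 1 - f x != 0] !=set0.
  by exists y; rewrite /= fy subr0 oner_neq0.
have cz : cozero R [set x | 1 - f x != 0] by exists (fun x => 1 - f x).
exists (exist _ [set x | 1 - f x != 0] (conj ne cz)).
move=> x /= fx; apply: VU; apply: contrapT => nVx.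
by move: fx; rewrite (_ : f x = 1) ?subrr ?eqxx//; apply: f1; exists x.
Qed.

(** The reflection principle through which a winning strategy is used: it
turns a property of infinite plays into one about a finite sequence of indices.
If every [s] had a counterexample [f s], then the play in which Player II
answers the position coded by [s] with [u (f s)] would follow the rules and
have a union disjoint from [V]. *)
Lemma winning_strategy_meets (sigma : seq (Sigma R Y) -> Sigma R Y)
    (u : nat -> Sigma R Y) (V : set Y) :
  winning_strategy sigma -> open V -> V !=set0 ->
  exists s : seq nat,
    forall k, u k `<=` sigma (map u s) -> (u k : set Y) `&` V !=set0.
Proof.
move=> win oV V0; apply: contrapT => /forallNP H.
have /choice[f fP] : forall s, exists k,
    u k `<=` sigma (map u s) /\ (u k : set Y) `&` V = set0.
  move=> s; have /existsNP[k /not_implyP[uk /set0P/negP]] := H s.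
  by rewrite negbK => /eqP ?; exists k.
pose hist := fix hist n :=
  if n is n'.+1 then rcons (hist n') (f (hist n')) else [::].
pose B n := u (f (hist n)).
have mkB n : mkseq B n = map u (hist n).
  by elim: n => // n IH; rewrite mkseqS IH /= map_rcons.
have /(_ V V0 oV) : dense (\bigcup_(n in [set: nat]) (B n : set Y)).
  by apply: win => k; rewrite mkB; exact: (fP _).1.
move=> [x [Vx [n _ Bnx]]].
by have : set0 x by rewrite -(fP (hist n)).2.
Qed.

End Cozero.

(** * Boxes in a product *)

Section Product.
Context {R : realType} {I : choiceType} (X : I -> topologicalType).
Implicit Types (S : seq I) (x : prod_topology X).

Definition box S (u : forall i, set (X i)) : set (prod_topology X) :=
  [set x | forall i, i \in S -> u i (x i)].

Lemma box_neq0 S (u : forall i, set (X i)) :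
  (forall i, u i !=set0) -> box S u !=set0.
Proof.
move=> u0; exists (fun i => sval (cid (u0 i))) => i _.
exact: svalP (cid (u0 i)).
Qed.

(** Since the other sides are non-empty, any point of the side [u i] is the
[i]-th coordinate of a point of the box. *)
Lemma box_side S (u : forall i, set (X i)) i (A : set (X i)) :
  (forall j, u j !=set0) -> i \in S -> box S u `<=` proj i @^-1` A ->
  u i `<=` A.
Proof.
move=> /(box_neq0 S)[p pS] iS SA y uy.
have /SA : box S u (dfwith p i y) by move=> j /pS; case: dfwithP.
by rewrite /= /proj dfwithin.
Qed.

(** The sets containing a box around [x] form a filter that converges to [x]
along every coordinate, hence for the supremum of the coordinate topologies. *)
Lemma nbhs_box x (U : set (prod_topology X)) : nbhs x U ->
  exists S v, (forall i, nbhs (x i) (v i)) /\ box S v `<=` U.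
Proof.
pose F : set_system (forall i, X i) := [set U |
  exists S v, (forall i, nbhs (x i) (v i)) /\ box S v `<=` U].
have FF : Filter F.
  split.
  - by exists [::], (fun i => setT); split=> // i; exact: filterT.
  - move=> A B [S [v [nv SA]]] [T [w [nw TB]]].
    exists (S ++ T), (fun i => v i `&` w i); split=> [i|z bz].
      exact: filterI.
    split; [apply: SA|apply: TB] => i iS.
      by have [] := bz i; rewrite ?mem_cat ?iS.
    by have [] := bz i; rewrite ?mem_cat ?iS ?orbT.
  - move=> A B AB [S [v [nv SA]]]; exists S, v; split=> //.
    exact: subset_trans AB.
move: U; change (F --> x); apply/cvg_sup => i A.
move=> [B [[C oC <-] Cx] BA].
exists [:: i], (dfwith (fun=> setT) i C); split=> [j|z bz].
  case: dfwithP => [|k _]; last exact: filterT.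
  exact: open_nbhs_nbhs.
apply: BA; have /= := bz i; rewrite inE eqxx dfwithin; exact.
Qed.

Lemma open_box_Sigma (U : set (prod_topology X)) :
  (forall i, completely_regular_space (X i)) -> open U -> U !=set0 ->
  exists b : seq I * (forall i, Sigma R (X i)), box b.1 (fun i => b.2 i) `<=` U.
Proof.
move=> crX oU [x Ux].
have [S [v [nv SU]]] := nbhs_box (open_nbhs_nbhs (conj oU Ux)).
have u i := cid (completely_regular_Sigma (R := R) (crX i) (nv i)).
exists (S, fun i => sval (u i)); apply: subset_trans SU => z bz i iS.
exact: svalP (u i) _ (bz i iS).
Qed.

(** * The strategy on the product *)

(** Strategies see only replies, so a coordinate must be named through them:
the code [(k, l, s)] refers to the coordinate at place [l] in the support of
the [k]-th box.  This makes the moves of Player I range over a countable set of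
codes although the index type is arbitrary.  An out-of-range place gives no
constraint, so that every code denotes a co-zero set. *)
Definition coded_side (sigma : forall i, seq (Sigma R (X i)) -> Sigma R (X i))
    (b : nat -> seq I * (forall i, Sigma R (X i))) (e : nat * nat * seq nat) :
    set (prod_topology X) :=
  if onth (b e.1.1).1 e.1.2 is Some i
  then proj i @^-1` (sigma i [seq (b k).2 i | k <- e.2] : set (X i)) else setT.

Lemma coded_side_cozero sigma b e : cozero R (coded_side sigma b e).
Proof.
rewrite /coded_side; case: onth => [i|]; last exact: cozeroT.
by apply: cozero_preimage; [exact: proj_continuous|exact: Sigma_cozero].
Qed.

(** Compactness enters only through complete regularity, which makes boxes with
co-zero sides a pi-base of the product. *)
Theorem I_favorable_cozero_prod :
  (forall i, completely_regular_space (X i)) ->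
  (forall i, I_favorable_cozero R (X i)) ->
  I_favorable_cozero R (prod_topology X).
Proof.
move=> crX favX.
pose sigma i := sval (cid (favX i)).
have sigmaP i : winning_strategy (sigma i) := svalP (cid (favX i)).
(* Player I replaces each reply of Player II by a box inside it. *)
have /choice[bx bxP] (A : Sigma R (prod_topology X)) :
    exists b : seq I * (forall i, Sigma R (X i)),
      box b.1 (fun i => b.2 i) `<=` A.
  apply: open_box_Sigma => //; last exact: Sigma_neq0.
  exact/cozero_open/Sigma_cozero.
have prod0 : [set: prod_topology X] !=set0.
  by exists (fun i => sval (cid (Sigma_neq0 (sigma i [::])))).
pose whole : Sigma R (prod_topology X) := exist _ setT (conj prod0 cozeroT).
pose C : countType := seq (nat * nat * seq nat).
have [code codeP] := cofinal_enumeration ([::] : C).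
(* [W h c] is the move coded by [c], read from the finite history [h].  It may
   be empty, or mention boxes not yet played: [tau] guards against the former,
   and the code is used only at rounds that are late enough for the latter. *)
pose W (h : seq (Sigma R (prod_topology X))) (c : C) :=
  [set x | forall e, e \in c ->
    coded_side sigma (fun k => bx (nth whole h k)) e x].
have cozW h c : cozero R (W h c).
  by apply: cozero_bigcap_seq => e; exact: coded_side_cozero.
pose tau h := if pselect (W h (code (size h)) !=set0) is left W0
  then exist _ _ (conj W0 (cozW _ _)) else whole.
exists tau => B Btau O O0 oO.
pose S k := (bx (B k)).1; pose u k i := (bx (B k)).2 i.
have SuB k : box (S k) (u k) `<=` B k by exact: bxP.
have [x Ox] := O0.
have [T [v [nv TO]]] := nbhs_box (open_nbhs_nbhs (conj oO Ox)).
have /choice[s sP] i : exists s : seq nat, forall k,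
    u k i `<=` sigma i (map (u^~ i) s) -> (u k i : set (X i)) `&` v i !=set0.
  have [|s sP] := winning_strategy_meets (u^~ i) (sigmaP i)
    (open_interior (v i)); first by exists (x i); exact: nv.
  by exists s => k /sP[y [uy /interior_subset vy]]; exists y.
have /choice[loc locP] i : exists p : nat * nat,
    (exists k, i \in S k) -> onth (S p.1) p.2 = Some i.
  have [[k ik]|nS] := pselect (exists k, i \in S k); last by exists (0, 0)%N.
  by move/onthP: ik => [l kl]; exists (k, l).
(* A coordinate in none of the supports has no code, but it is not constrained
   by the box inside any reply either. *)
pose T' := [seq i <- T | `[< exists k, i \in S k >]].
pose c : C := [seq (loc i, s i) | i <- T'].
(* From round [N] on, all replies that [c] refers to have been made. *)
pose N := (\max_(i <- T') maxn (loc i).1 (\max_(k <- s i) k)).+1.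
have [m Nm codem] := codeP c N.
have ltm k : (k < N)%N -> nth whole (mkseq B m) k = B k.
  by move=> kN; rewrite nth_mkseq// (leq_trans kN).
have sideE i : i \in T' ->
    coded_side sigma (fun k => bx (nth whole (mkseq B m) k)) (loc i, s i) =
    proj i @^-1` (sigma i (map (u^~ i) (s i)) : set (X i)).
  move=> iT'; have := iT'; rewrite mem_filter => /andP[/asboolP iS _].
  have mN k : (k <= maxn (loc i).1 (\max_(k <- s i) k))%N -> (k < N)%N.
    by move=> kle; rewrite ltnS (leq_trans kle)//; exact: leq_bigmax_seq iT' _.
  rewrite /coded_side /= ltm ?mN ?leq_maxl// locP//.
  congr (_ @^-1` (sval (sigma i _))); apply/eq_in_map => k ks.
  by rewrite ltm// mN// leq_max leq_bigmax_seq// orbT.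
have WE y : W (mkseq B m) c y <->
    forall i, i \in T' -> (sigma i (map (u^~ i) (s i)) : set (X i)) (y i).
  split=> [Wy i iT'|sy e /mapP[i iT' ->]].
    have : (loc i, s i) \in c by exact: map_f.
    by move/Wy; rewrite sideE.
  by rewrite sideE//; exact: sy.
have W0 : W (mkseq B m) c !=set0.
  exists (fun i => sval (cid (Sigma_neq0 (sigma i (map (u^~ i) (s i)))))).
  by apply/WE => i _; exact: svalP (cid _).
have BW : B m `<=` W (mkseq B m) c.
  have := Btau m; rewrite /tau size_mkseq codem; case: pselect => //.
(* The coordinates of a point common to the reply and the given open set. *)
have z i : {y : X i |
    (i \in S m -> (u m i : set (X i)) y) /\ (i \in T -> v i y)}.
  apply: cid; have [iS|iS] := boolP (i \in S m); last first.
    by exists (x i); split=> // _; exact: nbhs_singleton.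
  have [iT|iT] := boolP (i \in T); last first.
    by have [y uy] := Sigma_neq0 (u m i); exists y.
  suff [y [uy vy]] : (u m i : set (X i)) `&` v i !=set0 by exists y.
  apply: sP; apply: (box_side (S := S m) (u := fun i => u m i)) => //.
    by move=> j; exact: Sigma_neq0.
  move=> y /SuB/BW/WE; apply; rewrite mem_filter iT andbT.
  by apply/asboolP; exists m.
exists (fun i => sval (z i)); split.
  by apply: TO => i; exact: (svalP (z i)).2.
by exists m => //; apply: SuB => i; exact: (svalP (z i)).1.
Qed.

End Product.

Theorem corollary1p2 (R : realType) (Lambda : Type)
    (X : Lambda -> topologicalType)
    (Xcompact : forall a : Lambda, compact [set: X a])
    (Xhausdorff : forall a : Lambda, hausdorff_space (X a))
    (Xfavorable : forall a : Lambda, I_favorable_cozero R (X a)) :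
  I_favorable_cozero R (prod_topology X).
Proof.
(* Finite supports are sequences, whose membership test needs an equality test
   on the index type. *)
apply: (@I_favorable_cozero_prod R {classic Lambda} X) => // a.
apply: (@normal_completely_regular R).
  exact: (compact_normal (Xhausdorff a) (Xcompact a)).
exact: hausdorff_accessible.
Qed.
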